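(* Let $A(z)=a_3z^3+a_2z^2+a_1z+a_0$ and $B(z)=b_3z^3+b_2z^2+b_1z+b_0$ be polynomials with complex coefficients (of degree at most three), and let $w$ be a positive weight function on $[0,2\pi]$ satisfying $$\frac{d}{d\theta}\left[A(e^{i\theta})w(\theta)\right]=B(e^{i\theta})w(\theta),\qquad 0\le\theta\le 2\pi,$$ and $A(1)[w(2\pi)-w(0)]=0$. Then the Verblunsky coefficients $\alpha_n$ of the associated monic orthogonal polynomials on the unit circle satisfy, for $n\ge3$, $$\begin{aligned} &[(n-1)\overline{a}_0-i\overline{b}_0](1-|\alpha_{n-1}|^2)\alpha_{n-2}+[(n-1)\overline{a}_3+i\overline{b}_3](1-|\alpha_n|^2)\alpha_{n+1}\\ &\quad=-\{(n-1)\overline{a}_2+i\overline{b}_2-[i\overline{b}_3+(n-1)\overline{a}_3]\alpha_n\overline{\alpha}_{n-1}-2\overline{a}_3\overline{\ell}_{n,n-1}\}\alpha_n\\ &\qquad-\{(n+1)\overline{a}_1-i\overline{b}_1+[i\overline{b}_0-(n+1)\overline{a}_0]\overline{\alpha}_n\alpha_{n-1}-2\overline{a}_0\ell_{n,n-1}\}\alpha_{n-1}. \end{aligned}$$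
   Context: Inner product: $\langle f,g\rangle=\int_0^{2\pi}f(e^{i\theta})\overline{g(e^{i\theta})}\,w(\theta)\,d\theta$. $\{\Phi_n\}_{n\ge0}$ is the sequence of monic orthogonal polynomials, $\deg\Phi_n=n$, $\langle\Phi_n,\Phi_m\rangle=0$ for $n\ne m$, written $\Phi_n(z)=z^n+\ell_{n,n-1}z^{n-1}+\cdots+\ell_{n,1}z+\ell_{n,0}$. Verblunsky coefficients: $\alpha_{n-1}=-\overline{\ell}_{n,0}=-\overline{\Phi_n(0)}$ for $n\ge1$, and $\alpha_{-1}=-1$. The Pearson equation is understood with $\theta\mapsto A(e^{i\theta})w(\theta)$ absolutely continuous on $[0,2\pi]$ and the equation holding almost everywhere; $A(1)[w(2\pi)-w(0)]$ denotes the difference of the boundary values of $A(e^{i\theta})w(\theta)$ at $2\pi$ and $0$. *)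

(* Defs.v *)
From mathcomp Require Export all_boot all_order all_algebra.
From mathcomp Require Export all_classical all_reals all_analysis.
From mathcomp Require Export complex.

Set Implicit Arguments.
Unset Strict Implicit.
Unset Printing Implicit Defensive.

Export Order.TTheory GRing.Theory Num.Theory.
Export numFieldNormedType.Exports.

Global Open Scope classical_set_scope.
Global Open Scope complex_scope.
(* Opened last: [z^*] and ['i] are the numClosedFieldType operations on R[i],
   which are definitionally [conjc z] and [0 +i* 1]. *)
Global Open Scope ring_scope.

Section Defs.
Context {R : realType}.


Definition expi (t : R) : R[i] := cos t +i* sin t.

Definition circle_interval : set R := `[0, 2 * pi].

(* R[i] carries no R-normed-module structure in the library, so derivatives and
   integrals of R[i]-valued functions of a real variable are taken
   componentwise. *)
Definition is_derive_C (f : R -> R[i]) (t : R) (l : R[i]) : Prop :=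
  is_derive t 1 (fun s => complex.Re (f s)) (complex.Re l) /\
  is_derive t 1 (fun s => complex.Im (f s)) (complex.Im l).

Definition integral_C (D : set R) (f : R -> R[i]) : R[i] :=
  (\int[lebesgue_measure]_(t in D) complex.Re (f t))
  +i* (\int[lebesgue_measure]_(t in D) complex.Im (f t)).

(* The norm of R[i] takes values in R[i] (it is the modulus, as a real element),
   whence the comparison with e%:C. *)
Definition absolutely_continuous (a b : R) (f : R -> R[i]) : Prop :=
  forall e : R, 0 < e -> exists2 d : R, 0 < d &
    forall (n : nat) (u v : 'I_n -> R),
      (forall i, a <= u i /\ u i <= v i /\ v i <= b) ->
      trivIset [set: 'I_n] (fun i => `]u i, v i[%classic) ->
      \sum_(i < n) (v i - u i) < d ->
      \sum_(i < n) `|f (v i) - f (u i)| < e%:C.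

(* Positivity is required almost everywhere only, so that weights with zeros
   or poles (such as |1 - e^(i t)| ^ b) are covered. *)
Definition positive_weight (w : R -> R) : Prop :=
  lebesgue_measure.-integrable circle_interval (EFin \o w) /\
  {ae lebesgue_measure, forall t, circle_interval t -> 0 < w t}.

Definition inner (w : R -> R) (f g : R[i] -> R[i]) : R[i] :=
  integral_C circle_interval
    (fun t => f (expi t) * (g (expi t))^* * (w t)%:C).

Definition monic_orthogonal_polynomials (w : R -> R)
    (Phi : nat -> {poly R[i]}) : Prop :=
  (forall n, Phi n \is monic /\ size (Phi n) = n.+1) /\
  (forall n m : nat, n != m -> inner w (horner (Phi n)) (horner (Phi m)) = 0).

(* alpha_k = - conj (Phi_(k+1)(0)) for k >= 0; at k = -1 the same formula gives
   the usual convention alpha_(-1) = -1, since Phi_0 = 1. *)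
Definition verblunsky (Phi : nat -> {poly R[i]}) (k : nat) : R[i] :=
  - ((Phi k.+1).[0])^*.

Definition pearson (w : R -> R) (A B : {poly R[i]}) : Prop :=
  absolutely_continuous 0 (2 * pi) (fun t => A.[expi t] * (w t)%:C) /\
  {ae lebesgue_measure, forall t, circle_interval t ->
    is_derive_C (fun s => A.[expi s] * (w s)%:C) t (B.[expi t] * (w t)%:C)}.

End Defs.

(* Main.v *)
Require Import Defs.
From mathcomp Require Import measurable_realfun zify ring lra.

Set Implicit Arguments.
Unset Strict Implicit.
Unset Printing Implicit Defensive.

(* Write L(f) for the integral of f(e^(it)) w(t). The Pearson equation and the
   boundary condition give L(i z f' A + f B) = 0 for every Laurent polynomial f,
   by the fundamental theorem of calculus for absolutely continuous functions.
   Take f = z^(-n-1) Phi_n^2. In the resulting identity orthogonality kills all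
   moments L(Phi_n z^(-k)) with 0 <= k < n; only L(Phi_n z^(-n-1)),
   L(Phi_n z^(-n)), L(Phi_n z) and L(Phi_n z^2) survive, and the Szego
   recursion expresses each of them through the Verblunsky coefficients and the
   subleading coefficient of Phi_n. Dividing by |Phi_n|^2 and conjugating gives
   the recurrence. *)

(** * Absolute continuity and the fundamental theorem of calculus *)

Section AbsoluteContinuity.
Context {R : realType}.
Implicit Types (f g h : R -> R) (s : seq (R * R)).
Notation mu := (@lebesgue_measure R).

(* Nonoverlapping intervals [p.1, p.2] in [a, b], listed from right to left. *)
Fixpoint chain (a b : R) s : bool :=
  if s is p :: s' then [&& p.1 <= p.2, p.2 <= b & chain a p.1 s'] else a <= b.

(** Real-valued absolute continuity tested on lists instead of indexed families: sums go by
    induction, and a new rightmost interval is a cons. *)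
Definition AC (a b : R) f : Prop := forall e, 0 < e -> exists2 d, 0 < d &
  forall s, chain a b s -> \sum_(p <- s) (p.2 - p.1) < d ->
    \sum_(p <- s) `|f p.2 - f p.1| < e.

(** Half-open intervals keep neighbours with a common endpoint disjoint, so the measure is the sum
    of the lengths. *)
Definition chain_set s : set R := \big[setU/set0]_(p <- s) `]p.1, p.2]%classic.

Lemma chain_le a b s : chain a b s -> a <= b.
Proof.
elim: s b => //= -[u v] s IH b /and3P[/= uv vb /IH au].
exact: le_trans au (le_trans uv vb).
Qed.

Lemma chain_in a b s p : chain a b s -> p \in s -> a <= p.1 /\ p.1 <= p.2 /\ p.2 <= b.
Proof.
elim: s b => //= -[u v] s IH b /and3P[/= uv vb cs]; rewrite inE => /predU1P[->/=|ps].
  by split=> //; exact: chain_le cs.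
have [ap [pp pu]] := IH _ cs ps; split=> //; split=> //.
exact: le_trans pu (le_trans uv vb).
Qed.

Lemma chain_nth a b s z i j : chain a b s -> (i < j < size s)%N ->
  (nth z s j).2 <= (nth z s i).1.
Proof.
elim: s b i j => [|[u v] s IH] b i j /=; first by rewrite andbF.
move=> /and3P[/= uv vb cs]; case: j => [|j]; first by rewrite ltn0.
case: i => [|i] /=; last by rewrite !ltnS; apply: IH cs.
by rewrite ltnS => js; have [_ []] := chain_in cs (mem_nth z js).
Qed.

Lemma chain_set_sub a b s : chain a b s -> chain_set s `<=` `]a, b]%classic.
Proof.
rewrite /chain_set; elim: s b => [|[u v] s IH] b; first by rewrite big_nil => _; apply: sub0set.
move=> /= /and3P[/= uv vb cs]; rewrite big_cons subUset; split.
  by move=> x /=; rewrite !in_itv/= => /andP[ux /le_trans->//]; rewrite (le_lt_trans (chain_le cs) ux).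
apply: subset_trans (IH _ cs) _ => x /=; rewrite !in_itv/= => /andP[-> xu] /=.
by rewrite (le_trans xu)// (le_trans uv).
Qed.

Lemma measurable_chain_set s : measurable (chain_set s).
Proof. by apply: bigsetU_measurable => i _; exact: measurable_itv. Qed.

Lemma chain_disj a u v s : chain a u s -> [disjoint `]u, v]%classic & chain_set s].
Proof.
move=> cs; apply/disj_setPS => x [/=]; rewrite in_itv/= => /andP[ux _].
by move=> /(chain_set_sub cs)/=; rewrite in_itv/= leNgt ux andbF.
Qed.

Lemma mu_chain_set a b s : chain a b s ->
  mu (chain_set s) = (\sum_(p <- s) (p.2 - p.1))%:E.
Proof.
elim: s b => [|[u v] s IH] b /=; first by rewrite /chain_set !big_nil measure0.
move=> /and3P[/= uv vb cs]; rewrite /chain_set !big_cons measureU/=.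
- by rewrite -/(chain_set s) (IH _ cs) lebesgue_measure_itv/= lte_fin EFinD; case: ltgtP uv => // ->; rewrite subrr.
- exact: measurable_itv.
- exact: measurable_chain_set.
- by apply/eqP; apply: (chain_disj v cs).
Qed.

(** The increments over a chain are bounded by the integral of |g| over its union, and that integral
    is small on sets of small measure. *)
Lemma integral_AC a b g : mu.-integrable setT (EFin \o g) ->
  AC a b (fun x => \int[mu]_(t in `]-oo, x]) g t).
Proof.
move=> ig e e0; have [d [d0 Hd]] := integral_normr_continuous ig e0.
exists d => // s cs sd.
have {}sd : (mu (chain_set s) < d%:E)%E by rewrite (mu_chain_set cs) lte_fin.
apply: le_lt_trans (Hd _ (measurable_chain_set s) sd).
elim: s b cs {sd} => [|[u v] s IH] b /=.
  by rewrite !big_nil /chain_set big_nil Rintegral_set0.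
have igA A : measurable A -> mu.-integrable A (EFin \o g).
  by move=> mA; apply: integrableS ig.
have inA A : measurable A -> mu.-integrable A (EFin \o (fun x => `|g x|)).
  by move=> /igA/integrable_norm.
move=> /and3P[/= uv vb cs]; rewrite /chain_set !big_cons -/(chain_set s) Rintegral_setU; last 4 first.
- exact: measurable_itv.
- exact: measurable_chain_set.
- by apply: inA; apply: measurableU; [exact: measurable_itv|exact: measurable_chain_set].
- exact: chain_disj cs.
apply: lerD; last exact: IH cs.
rewrite Rintegral_itvB//=.
- by apply: le_normr_Rintegral; [exact: measurable_itv|apply: igA; exact: measurable_itv].
- by apply: igA; exact: measurable_itv.
Qed.

Lemma ACB a b f g : AC a b f -> AC a b g -> AC a b (f \- g).
Proof.
move=> af ag e e0; have e20 : 0 < e / 2 by rewrite divr_gt0.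
have [d d0 Hd] := af _ e20; have [d' d'0 Hd'] := ag _ e20.
exists (Num.min d d'); first by rewrite lt_min d0.
move=> s cs; rewrite lt_min => /andP[sd sd'].
rewrite [ltRHS]splitr; apply: le_lt_trans (ltrD (Hd _ cs sd) (Hd' _ cs sd')).
rewrite -big_split/=; apply: ler_sum => p _ /=.
rewrite [X in `|X| <= _](_ : _ = (f p.2 - f p.1) - (g p.2 - g p.1)); last by ring.
exact: ler_normB.
Qed.

(** Let c be the supremum of the points of [a, b] where [P] holds. The local hypothesis at c carries
    [P] from a point just left of c to points right of c, which forces c = b. *)
Lemma real_induction (a b : R) (P : R -> Prop) : a <= b -> P a ->
  (forall x, a <= x <= b -> exists2 e, 0 < e &
     forall y z, a <= y <= x -> x <= z <= b -> x - y < e -> z - x < e -> P y -> P z) ->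
  P b.
Proof.
move=> ab Pa H; pose S := [set x | a <= x <= b /\ P x].
have Sa : S a by rewrite /S/= lexx ab.
have hS : has_sup S by split; [exists a|exists b => x [/andP[]]].
pose c := sup S.
have cb : c <= b by apply: ge_sup => [|x [/andP[]]//]; exists a.
have ac : a <= c by apply: ub_le_sup => //; case: hS.
have [|e e0 He] := H c; first by rewrite ac cb.
have [y [/andP[ay yb] Py] cy] := sup_adherent e0 hS; rewrite -/c in cy.
have yc : y <= c by apply: ub_le_sup; [case: hS|split=> //; rewrite ay].
have Hz z : c <= z <= b -> z - c < e -> P z.
  by move=> cz zc; apply: (He y) => //; [rewrite ay|lra].
have [bc|bc] := ltP (b - c) e; first by apply: Hz => //; rewrite cb lexx.
have : c + e / 2 <= c.
  apply: ub_le_sup; [by case: hS|split; first by apply/andP; split; lra].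
  by apply: Hz; [apply/andP; split|]; lra.
by rewrite leNgt ltrDl divr_gt0.
Qed.

Lemma is_derive0_small h (x e : R) : is_derive x 1 h 0 -> 0 < e ->
  exists2 d, 0 < d & forall y, `|y - x| < d -> `|h y - h x| <= e * `|y - x|.
Proof.
move=> [/cvg_ex[/= l hl] hx] e0.
have l0 : l = 0.
  by rewrite -hx; apply/esym/cvg_lim => //; exact: hl.
move: hl; rewrite l0 => /cvgrPdist_le/(_ _ e0)[d /= d0 Hd].
exists d => // y yx; have [->|xy] := eqVneq y x; first by rewrite !subrr normr0 mulr0.
have yx0 : y - x != 0 by rewrite subr_eq0.
have := Hd (y - x); rewrite /= sub0r normrN => /(_ yx yx0).
rewrite /ball_/= sub0r normrN scaler1 subrK /GRing.scale/= normrM normfV.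
by rewrite mulrC ler_pdivrMr// normr_gt0.
Qed.

(* Continuous induction along [a, b]: near a point where h' = 0 the increments
   of h are at most e |y - x|, and near an exceptional point they are recorded
   in a chain of intervals contained in an open set U of small measure. *)
Lemma AC_is_derive0_cst a b h : a <= b -> AC a b h ->
  {ae mu, forall t, t \in `[a, b] -> is_derive t 1 h 0} -> h b = h a.
Proof.
move=> ab ach [N [mN N0 hN]]; apply/eqP; rewrite -subr_eq0 -normr_le0.
apply/ler_addgt0Pr => e e0; rewrite add0r.
have e20 : 0 < e / 2 by rewrite divr_gt0.
have [d d0 Hd] := ach _ e20.
have Noo : (mu N < +oo)%E by rewrite N0 ltry.
have [U [oU NU Ud]] := lebesgue_regularity_outer mN Noo d0.
have mU : measurable U by exact: open_measurable.
(* Outer regularity bounds the measure of U minus N; since N is null, this bounds U itself. *)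
have {}Ud : (mu U < d%:E)%E.
  rewrite -(setDUK NU) measureU//; last 2 first.
  - exact: measurableD.
  - by rewrite setDIK.
  by rewrite [X in (X + _ < _)%E]N0 add0e.
(* Increments of slope [c] cost at most e / 2 over [a, b], and the chain costs the other e / 2. The
   + 1 keeps the divisor positive when a = b. *)
pose c := e / 2 / (b - a + 1).
have ba0 : 0 < b - a + 1 by lra.
have c0 : 0 < c by rewrite divr_gt0.
pose P x := exists s, [/\ chain a x s, chain_set s `<=` U &
  `|h x - h a| <= c * (x - a) + \sum_(p <- s) `|h p.2 - h p.1|].
have : P b.
  apply: (real_induction ab).
    exists [::]; split => /=; first exact: lexx.
    - by rewrite /chain_set big_nil.
    - by rewrite big_nil !subrr normr0 mulr0 addr0.
  move=> x /andP[ax xb].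
  have [Ux|nUx] := pselect (U x).
    have [r /= r0 Hr] := open_subball oU Ux.
    exists (r / 2); first by rewrite divr_gt0.
    move=> y z /andP[ay yx] /andP[xz zb] yxr zxr [s [cs sU Hs]].
    exists ((y, z) :: s); split => /=.
    - by rewrite lexx cs (le_trans yx).
    - rewrite /chain_set big_cons subUset; split => //= t /=; rewrite in_itv/= => /andP[yt tz].
      apply: (Hr (r / 2)) => //=.
      + by rewrite /ball/= sub0r normrN gtr0_norm ?divr_gt0// ltr_pdivrMr//; lra.
      + by rewrite divr_gt0.
      + by rewrite /ball/= ltr_norml; apply/andP; split; lra.
    - rewrite big_cons/=.
      have := ler_normD (h z - h y) (h y - h a); rewrite addrA subrK.
      have : c * (y - a) <= c * (z - a) by rewrite ler_pM2l//; lra.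
      lra.
  have hx : is_derive x 1 h 0.
    apply: contrapT => nh; apply/nUx/NU/hN => /= /(_ _); rewrite in_itv/= ax xb.
    by move=> /(_ isT).
  have [r r0 Hr] := is_derive0_small hx c0.
  exists r => // y z /andP[ay yx] /andP[xz zb] yxr zxr [s [cs sU Hs]].
  exists s; split => //.
    case: s cs {sU Hs} => /= [|p s /and3P[-> py ->]]; first lra.
    by rewrite andbT/=; lra.
  have := Hr y; rewrite distrC ger0_norm ?subr_ge0// => /(_ yxr).
  have := Hr z; rewrite (ger0_norm (_ : 0 <= z - x)) ?subr_ge0// => /(_ zxr).
  have := ler_normD (h z - h x) ((h x - h y) + (h y - h a)); have := ler_normD (h x - h y) (h y - h a).
  rewrite (distrC (h x)) !addrA !subrK.
  rewrite !mulrBr in Hs *; lra.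
move=> [s [cs sU Hs]].
have : (mu (chain_set s) <= mu U)%E by apply: le_measure; rewrite ?inE//; exact: measurable_chain_set.
move=> /le_lt_trans/(_ Ud); rewrite (mu_chain_set cs) lte_fin => /(Hd _ cs) ss.
apply: (le_trans Hs).
have : c * (b - a) <= e / 2.
  by rewrite /c mulrAC ler_pdivrMr// ler_pM2l//; lra.
lra.
Qed.

(** By Lebesgue differentiation the indefinite integral F of g has derivative g almost everywhere,
    so f - F is absolutely continuous with derivative zero almost everywhere, hence constant. *)
Lemma AC_FTC a b f g : a < b -> AC a b f -> mu.-integrable `[a, b]%classic (EFin \o g) ->
  {ae mu, forall t, t \in `[a, b] -> is_derive t 1 f (g t)} ->
  \int[mu]_(t in `[a, b]) g t = f b - f a.
Proof.
move=> ab acf ig dfg.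
(* Extending g by zero makes F an integral from minus infinity, defined on the whole line. *)
have iG : mu.-integrable setT (EFin \o (g \_ `[a, b]%classic)).
  by rewrite -restrict_EFin; apply: (integrable_mkcond _ _).1 ig; exact: measurable_itv.
have igA A : measurable A -> mu.-integrable A (EFin \o (g \_ `[a, b]%classic)).
  by move=> mA; apply: integrableS iG.
have lG := @open_integrable_locally _ _ _ openT iG.
have dF := FTC1Ny (fun y => igA _ (measurable_itv _)) lG.
have acF := integral_AC a b iG.
set F := (fun x => _) in acF; rewrite -/F in dF.
have := AC_is_derive0_cst (ltW ab) (ACB acf acF) _.
have -> : \int[mu]_(t in `[a, b]) g t = F b - F a.
  rewrite /F Rintegral_itvB ?bnd_simp ?(ltW ab)//; last by apply: igA; exact: measurable_itv.
  rewrite Rintegral_itv_obnd_cbnd; last by apply: igA; exact: measurable_itv.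
  by apply: eq_Rintegral => x xab; rewrite patchE xab.
move=> /= H; suff : f b - F b = f a - F a by lra.
apply: H; have aeF := ae_filter_ringOfSetsType mu.
move: dF dfg; apply: filterS2 => t [Ft1 Ft2] dft tab.
have {}dft := dft tab.
have : is_derive t 1 F (g t).
  have := derivableP Ft1; rewrite -derive1E Ft2 patchE mem_set//.
by move=> dFt; have := is_deriveB dft dFt; rewrite subrr.
Qed.

End AbsoluteContinuity.

(** * Closure properties of absolutely continuous functions *)

Section ACalgebra.
Context {R : realType}.
Implicit Types (f g h : R -> R) (s : seq (R * R)) (a b : R).

Lemma AC_lipschitz a b f : (forall u v, a <= u <= v -> v <= b -> `|f v - f u| <= v - u) ->
  AC a b f.
Proof.
move=> H e e0; exists e => // s cs; apply: le_lt_trans.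
rewrite !big_seq; apply: ler_sum => p ps.
by have [ap [pp pb]] := chain_in cs ps; apply: H => //; rewrite ap.
Qed.

Lemma AC_cst a b c : AC a b (fun=> c).
Proof. by apply: AC_lipschitz => u v /andP[_ uv] _; rewrite subrr normr0 subr_ge0. Qed.

Lemma AC_cos a b : AC a b (@cos R).
Proof.
apply: AC_lipschitz => u v /andP[_ uv] _.
have [|c _ ->] := @MVT_segment R cos (fun x => - sin x) u v uv.
  by apply: continuous_subspaceT => x; exact: continuous_cos.
by rewrite normrM (ger0_norm (_ : 0 <= v - u)) ?subr_ge0// ler_piMl ?subr_ge0// normrN ler_norml sin_le1 sin_geN1.
Qed.

Lemma AC_sin a b : AC a b (@sin R).
Proof.
apply: AC_lipschitz => u v /andP[_ uv] _.
have [|c _ ->] := @MVT_segment R sin (fun x => cos x) u v uv.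
  by apply: continuous_subspaceT => x; exact: continuous_sin.
by rewrite normrM (ger0_norm (_ : 0 <= v - u)) ?subr_ge0// ler_piMl ?subr_ge0// ler_norml cos_le1 cos_geN1.
Qed.

(** Over a length less than d, f moves by less than 1; continuous induction with radius d / 2 then
    propagates boundedness, the bound growing by 1 at each step. *)
Lemma AC_bounded a b f : a <= b -> AC a b f ->
  exists2 M, 0 <= M & forall x, a <= x <= b -> `|f x| <= M.
Proof.
move=> ab acf; have [d d0 Hd] := acf _ ltr01.
pose P y := exists2 M, 0 <= M & forall x, a <= x <= y -> `|f x| <= M.
have d20 : 0 < d / 2 by rewrite divr_gt0.
apply: (@real_induction _ a b P ab).
  exists `|f a| => // x; rewrite -eq_le => /eqP <-//.
move=> x /andP[ax xb]; exists (d / 2) => // y z /andP[ay yx] /andP[xz zb] xy zx [M M0 HM].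
exists (M + 1) => [|t /andP[at_ tz]]; first by rewrite addr_ge0.
have [ty|yt] := leP t y; first by rewrite (le_trans (HM t _))// ?at_ // lerDl.
have := Hd [:: (y, t)]; rewrite /= !big_seq1/= (ltW yt) ay (le_trans tz zb)/= => /(_ isT).
have -> : t - y < d by lra.
move=> /(_ isT) fty; have := HM y; rewrite ay lexx => /(_ isT) fy.
by have := ler_normD (f t - f y) (f y); rewrite subrK; lra.
Qed.

Lemma ACN a b f : AC a b f -> AC a b (fun x => - f x).
Proof.
move=> acf e e0; have [d d0 Hd] := acf _ e0; exists d => // s cs sd.
apply: le_lt_trans (Hd _ cs sd); apply: ler_sum => p _.
by rewrite -opprD normrN.
Qed.

Lemma ACD a b f g : AC a b f -> AC a b g -> AC a b (fun x => f x + g x).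
Proof.
move=> acf /ACN acg; have := ACB acf acg.
by under [X in AC _ _ X]funext do rewrite /= opprK.
Qed.

Lemma ACM a b f g : a <= b -> AC a b f -> AC a b g -> AC a b (fun x => f x * g x).
Proof.
move=> ab acf acg e e0.
have [M M0 HM] := AC_bounded ab acf; have [N N0 HN] := AC_bounded ab acg.
(* One positive constant dominating both bounds, also when both vanish. *)
have K0 : 0 < M + N + 1 by lra.
have e1 : 0 < e / 2 / (M + N + 1) by rewrite !divr_gt0.
have [d d0 Hd] := acf _ e1; have [d' d'0 Hd'] := acg _ e1.
exists (Num.min d d'); first by rewrite lt_min d0.
move=> s cs; rewrite lt_min => /andP[sd sd'].
have H1 := Hd _ cs sd; have H2 := Hd' _ cs sd'.
have le1 : \sum_(p <- s) `|f p.2 * g p.2 - f p.1 * g p.1| <=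
    (M + N + 1) * (\sum_(p <- s) `|f p.2 - f p.1| + \sum_(p <- s) `|g p.2 - g p.1|).
  rewrite -big_split/= mulr_sumr !big_seq; apply: ler_sum => p ps.
  have [ap [pp pb]] := chain_in cs ps.
  have -> : f p.2 * g p.2 - f p.1 * g p.1 =
    (f p.2 - f p.1) * g p.2 + f p.1 * (g p.2 - g p.1) by ring.
  apply: le_trans (ler_normD _ _) _; rewrite !normrM mulrDr lerD//.
    rewrite mulrC ler_wpM2r// (le_trans (HN _ _)) ?pb ?(le_trans ap)//; lra.
  rewrite ler_wpM2r// (le_trans (HM _ _)) ?ap ?(le_trans pp)//; lra.
apply: le_lt_trans le1 _.
rewrite mulrC -ltr_pdivlMr//.
have -> : e / (M + N + 1) = e / 2 / (M + N + 1) + e / 2 / (M + N + 1) by field; lra.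
exact: ltrD.
Qed.

End ACalgebra.

(** * Complex-valued functions of a real variable *)

Section ComplexValued.
Context {R : realType}.
Local Notation C := R[i].
Implicit Types (u v : R -> C) (p q : {poly C}) (D : set R) (w : R -> R).
Notation mu := (@lebesgue_measure R).

Lemma ReM (x y : C) :
  complex.Re (x * y) = complex.Re x * complex.Re y - complex.Im x * complex.Im y.
Proof. by case: x y => [a b] [c d]. Qed.

Lemma ImM (x y : C) :
  complex.Im (x * y) = complex.Re x * complex.Im y + complex.Im x * complex.Re y.
Proof. by case: x y => [a b] [c d]. Qed.

Lemma ReD (x y : C) : complex.Re (x + y) = complex.Re x + complex.Re y.
Proof. by case: x y => [a b] [c d]. Qed.

Lemma ImD (x y : C) : complex.Im (x + y) = complex.Im x + complex.Im y.
Proof. by case: x y => [a b] [c d]. Qed.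

Lemma Re_conj (x : C) : complex.Re x^* = complex.Re x.
Proof. by case: x. Qed.

Lemma Im_conj (x : C) : complex.Im x^* = - complex.Im x.
Proof. by case: x. Qed.

Definition AC_C a b u :=
  AC a b (fun t => complex.Re (u t)) /\ AC a b (fun t => complex.Im (u t)).

Lemma AC_C_cst a b (c : C) : AC_C a b (fun=> c).
Proof. by split; exact: AC_cst. Qed.

Lemma AC_CD a b u v : AC_C a b u -> AC_C a b v -> AC_C a b (fun t => u t + v t).
Proof.
move=> [ur ui] [vr vi]; split.
  by under [X in AC _ _ X]funext do rewrite ReD; exact: (ACD ur vr).
by under [X in AC _ _ X]funext do rewrite ImD; exact: (ACD ui vi).
Qed.

Lemma AC_CM a b u v : a <= b -> AC_C a b u -> AC_C a b v -> AC_C a b (fun t => u t * v t).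
Proof.
move=> ab [ur ui] [vr vi]; split.
  under [X in AC _ _ X]funext do rewrite ReM.
  exact: (ACB (ACM ab ur vr) (ACM ab ui vi)).
under [X in AC _ _ X]funext do rewrite ImM.
exact: (ACD (ACM ab ur vi) (ACM ab ui vr)).
Qed.

Lemma AC_C_conj a b u : AC_C a b u -> AC_C a b (fun t => (u t)^*).
Proof.
move=> [ur ui]; split.
  by under [X in AC _ _ X]funext do rewrite Re_conj.
by under [X in AC _ _ X]funext do rewrite Im_conj; exact: (ACN ui).
Qed.

Lemma AC_C_expi a b : AC_C a b (@expi R).
Proof. by split; [exact: AC_cos|exact: AC_sin]. Qed.

Lemma AC_C_horner a b p : a <= b -> AC_C a b (fun t => p.[expi t]).
Proof.
move=> ab; elim/poly_ind: p => [|p c IH].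
  by under [X in AC_C _ _ X]funext do rewrite horner0; exact: AC_C_cst.
under [X in AC_C _ _ X]funext do rewrite hornerMXaddC.
by apply: (AC_CD _ (AC_C_cst _ _ _)); apply: (AC_CM ab IH); exact: AC_C_expi.
Qed.

Lemma normc_ge_Im (z : C) : `|complex.Im z|%:C <= `|z|.
Proof.
by rewrite -normrN -ReiNIm complexiE (le_trans (normc_ge_Re _))// normrM normCi mulr1.
Qed.

(** A chain is a disjoint family indexed by positions in the list, and Re and Im are additive and do
    not increase the modulus. *)
Lemma absolutely_continuous_AC_C a b u : absolutely_continuous a b u -> AC_C a b u.
Proof.
move=> acu.
have acu' e : 0 < e -> exists2 d : R, 0 < d & forall s, chain a b s ->
    \sum_(p <- s) (p.2 - p.1) < d -> \sum_(p <- s) `|u p.2 - u p.1| < e%:C.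
  move=> e0; have [d d0 Hd] := acu _ e0; exists d => // s cs.
  pose z : R * R := (0, 0).
  rewrite (big_nth z) big_mkord => sd; rewrite (big_nth z) big_mkord.
  apply: (Hd _ (fun i => (nth z s i).1) (fun i => (nth z s i).2)) => //.
    by move=> i; exact: chain_in cs (mem_nth z (ltn_ord i)).
  move=> i j _ _ [x [/= ]]; rewrite !in_itv/= => /andP[ix xi] /andP[jx xj].
  apply/val_inj; case: (ltngtP i j) => // ij.
    have := @chain_nth _ _ _ _ z i j cs; rewrite ij ltn_ord => /(_ isT).
    by move=> /(lt_le_trans xj)/(lt_trans)/(_ ix); rewrite ltxx.
  have := @chain_nth _ _ _ _ z j i cs; rewrite ij ltn_ord => /(_ isT).
  by move=> /(lt_le_trans xi)/(lt_trans)/(_ jx); rewrite ltxx.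
have le_norm_sum (f : C -> R) s : (forall x, `|f x|%:C <= `|x|) -> {morph f : x y / x - y} ->
    (\sum_(p <- s) `|f (u p.2) - f (u p.1)|)%:C <= \sum_(p <- s) `|u p.2 - u p.1|.
  move=> Hf fB; rewrite (rmorph_sum (real_complex R)); apply: ler_sum => p _.
  by rewrite -fB; exact: Hf.
split=> e /acu'[d d0 Hd]; exists d => // s cs sd; rewrite -ltcR;
    apply: le_lt_trans (Hd _ cs sd).
  by apply: le_norm_sum => [x|x y]; [exact: normc_ge_Re|case: x y => ? ? [? ?]].
by apply: le_norm_sum => [x|x y]; [exact: normc_ge_Im|case: x y => ? ? [? ?]].
Qed.

Lemma is_derive_C_cst (c : C) t : is_derive_C (fun=> c) t 0.
Proof. by split; exact: is_derive_cst. Qed.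

Lemma is_derive_CD u v t du dv : is_derive_C u t du -> is_derive_C v t dv ->
  is_derive_C (fun s => u s + v s) t (du + dv).
Proof.
move=> [ur ui] [vr vi]; split; rewrite ?ReD ?ImD.
  by under [X in is_derive _ _ X]funext do rewrite ReD; exact: (is_deriveD ur vr).
by under [X in is_derive _ _ X]funext do rewrite ImD; exact: (is_deriveD ui vi).
Qed.

Lemma is_derive_CM u v t du dv : is_derive_C u t du -> is_derive_C v t dv ->
  is_derive_C (fun s => u s * v s) t (du * v t + u t * dv).
Proof.
move=> [ur ui] [vr vi]; split; rewrite ?ReD ?ImD ?ReM ?ImM.
  under [X in is_derive _ _ X]funext do rewrite ReM.
  apply: is_derive_eq (is_deriveB (is_deriveM ur vr) (is_deriveM ui vi)) _.
  by rewrite /GRing.scale/=; ring.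
under [X in is_derive _ _ X]funext do rewrite ImM.
apply: is_derive_eq (is_deriveD (is_deriveM ur vi) (is_deriveM ui vr)) _.
by rewrite /GRing.scale/=; ring.
Qed.

Lemma is_derive_C_conj u t du : is_derive_C u t du -> is_derive_C (fun s => (u s)^*) t du^*.
Proof.
move=> [ur ui]; split; rewrite ?Re_conj ?Im_conj.
  by under [X in is_derive _ _ X]funext do rewrite Re_conj.
by under [X in is_derive _ _ X]funext do rewrite Im_conj; exact: (is_deriveN ui).
Qed.

Lemma is_derive_C_expi t : is_derive_C (@expi R) t ('i * expi t).
Proof.
by split; rewrite -complexiE ?ReM ?ImM /= !(mul0r, mul1r, sub0r, add0r);
  [exact: is_derive_cos|exact: is_derive_sin].
Qed.

Lemma is_derive_C_horner p t :
  is_derive_C (fun s => p.[expi s]) t ('i * expi t * p^`().[expi t]).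
Proof.
elim/poly_ind: p => [|p c IH].
  under [X in is_derive_C X]funext do rewrite horner0.
  by rewrite deriv0 horner0 mulr0; exact: is_derive_C_cst.
under [X in is_derive_C X]funext do rewrite hornerMXaddC.
rewrite derivD derivM derivX derivC addr0 mulr1 !hornerE.
have := is_derive_CD (is_derive_CM IH (is_derive_C_expi t)) (is_derive_C_cst c t).
by rewrite addr0; congr is_derive_C; ring.
Qed.

(** * Componentwise integration against the weight *)

Definition continuous_C u :=
  continuous (fun t => complex.Re (u t)) /\ continuous (fun t => complex.Im (u t)).

Lemma is_derive_continuous_C u du : (forall t, is_derive_C u t (du t)) -> continuous_C u.
Proof.
move=> Hu; split=> t; have [[ur _] [ui _]] := Hu t;
  by apply: differentiable_continuous; apply/derivable1_diffP.
Qed.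

Lemma continuous_C_inner p q : continuous_C (fun t => p.[expi t] * (q.[expi t])^*).
Proof.
apply: is_derive_continuous_C => t.
exact: is_derive_CM (is_derive_C_horner p t) (is_derive_C_conj (is_derive_C_horner q t)).
Qed.

Definition integrable_C D u :=
  mu.-integrable D (EFin \o (fun t => complex.Re (u t))) /\
  mu.-integrable D (EFin \o (fun t => complex.Im (u t))).

Lemma integral_CD D u v : measurable D -> integrable_C D u -> integrable_C D v ->
  integral_C D (fun t => u t + v t) = integral_C D u + integral_C D v.
Proof.
move=> mD [ur ui] [vr vi]; rewrite /integral_C.
under eq_Rintegral do rewrite ReD.
under [X in _ +i* X]eq_Rintegral do rewrite ImD.
by rewrite !RintegralD.
Qed.

Lemma integral_C_conj D u : measurable D -> integrable_C D u ->
  integral_C D (fun t => (u t)^*) = (integral_C D u)^*.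
Proof.
move=> mD [ur ui]; rewrite /integral_C.
under eq_Rintegral do rewrite Re_conj.
under [X in _ +i* X]eq_Rintegral do rewrite Im_conj -mulN1r.
by rewrite RintegralZl// mulN1r.
Qed.

Lemma integral_CZ D (c : C) u : measurable D -> integrable_C D u ->
  integral_C D (fun t => c * u t) = c * integral_C D u.
Proof.
move=> mD [ur ui]; rewrite /integral_C.
have iZ (r : R) (f : R -> R) : mu.-integrable D (EFin \o f) ->
    mu.-integrable D (EFin \o (fun t => r * f t)).
  by move=> fi; apply: (@integrableZl _ _ _ mu D mD r _ fi).
under eq_Rintegral do rewrite ReM.
under [X in _ +i* X]eq_Rintegral do rewrite ImM.
rewrite RintegralB ?RintegralD ?RintegralZl//; try exact: iZ.
by case: c.
Qed.

(** A continuous factor is bounded on the compact interval, so it preserves integrability of w. *)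
Lemma integrable_C_weight w u : mu.-integrable circle_interval (EFin \o w) ->
  continuous_C u -> integrable_C circle_interval (fun t => u t * (w t)%:C).
Proof.
move=> iw [ur ui].
have iM (f : R -> R) : continuous f ->
    mu.-integrable circle_interval (EFin \o (fun t => f t * w t)).
  move=> cf.
  apply: (@integrableMr _ _ _ mu circle_interval _ f (EFin \o w)) => //.
  - exact: measurable_itv.
  - by apply: measurable_funTS; exact: continuous_measurable_fun.
  - have : compact (f @` circle_interval).
      apply: continuous_compact; last exact: segment_compact.
      exact: continuous_subspaceT.
    move=> /compact_bounded[M [Mr HM]]; exists M; split => // x Mx t It.
    by apply: HM => //; exists t.
split.
  by under [X in EFin \o X]funext do rewrite ReM mulr0 subr0; exact: iM.
by under [X in EFin \o X]funext do rewrite ImM mulr0 add0r; exact: iM.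
Qed.

Lemma FTC_C a b u du : a < b -> AC_C a b u -> integrable_C `[a, b]%classic du ->
  {ae mu, forall t, t \in `[a, b] -> is_derive_C u t (du t)} ->
  integral_C `[a, b]%classic du = u b - u a.
Proof.
move=> ab [ur ui] [dr di] Hu; have aeF := ae_filter_ringOfSetsType mu.
rewrite /integral_C (AC_FTC ab ur dr); last first.
  by move: Hu; apply: filterS => t Ht /Ht[].
rewrite (AC_FTC ab ui di); last first.
  by move: Hu; apply: filterS => t Ht /Ht[].
by case: (u b) (u a) => ? ? [? ?].
Qed.

End ComplexValued.

(** * Orthogonal polynomials on the unit circle *)

Section ReversedPolynomial.
Context {C : numClosedFieldType}.
Implicit Types p : {poly C}.

(* On the unit circle, revp n p = z^n * p^*. *)
Definition revp n p : {poly C} := \poly_(i < n.+1) (p`_(n - i))^*.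

Lemma coef_revp n p k : (k <= n)%N -> (revp n p)`_k = (p`_(n - k))^*.
Proof. by move=> kn; rewrite coef_poly ltnS kn. Qed.

Lemma revpE n p : revp n p = \sum_(i < n.+1) (p`_i)^* *: 'X^(n - i).
Proof.
rewrite /revp poly_def (reindex_inj rev_ord_inj)/=.
by apply: eq_bigr => i _; rewrite subSS subKn// -ltnS.
Qed.

Lemma poly4E (A : {poly C}) : (size A <= 4)%N ->
  A = A`_0 *: 1 + A`_1 *: 'X + A`_2 *: 'X^2 + A`_3 *: 'X^3.
Proof.
move=> sA; apply/polyP => i; rewrite !coefD !coefZ coef1 coefX !coefXn.
case: i => [|[|[|[|i]]]] /=; rewrite ?mulr1 ?mulr0 ?addr0 ?add0r//.
by rewrite nth_default// (leq_trans sA).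
Qed.

(** The matches encode that coefficients of negative index are zero. *)
Lemma coefM4 (A Q : {poly C}) k : (size A <= 4)%N ->
  (A * Q)`_k = A`_0 * Q`_k + (if k is k.+1 then A`_1 * Q`_k else 0)
    + (if k is k.+2 then A`_2 * Q`_k else 0)
    + (if k is k.+3 then A`_3 * Q`_k else 0).
Proof.
move=> sA; rewrite {1}(poly4E sA) !mulrDl !coefD -!scalerAl !coefZ mul1r coefXM !coefXnM.
by case: k => [|[|[|k]]]/=; rewrite ?subSS ?subn0 ?mulr0.
Qed.

End ReversedPolynomial.

(** * Orthogonal polynomials of a definite Hermitian form for which multiplication by z is
    isometric *)

Section OrthogonalPolynomials.
Context {C : numClosedFieldType}.
Variable S : {poly C} -> {poly C} -> C.
Hypothesis SD : forall p q r, S (p + q) r = S p r + S q r.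
Hypothesis SZ : forall c p q, S (c *: p) q = c * S p q.
Hypothesis SH : forall p q, S q p = (S p q)^*.
Hypothesis SX : forall p q, S ('X * p) ('X * q) = S p q.
Hypothesis S_eq0 : forall p, S p p = 0 -> p = 0.
Implicit Types p q r : {poly C}.

Lemma form0l q : S 0 q = 0.
Proof. by rewrite -(scale0r 0) SZ mul0r. Qed.

Lemma formN p q : S (- p) q = - S p q.
Proof. by rewrite -scaleN1r SZ mulN1r. Qed.

Lemma formB p q r : S (p - q) r = S p r - S q r.
Proof. by rewrite SD formN. Qed.

Lemma form_suml I (s : seq I) (F : I -> {poly C}) q :
  S (\sum_(i <- s) F i) q = \sum_(i <- s) S (F i) q.
Proof. by elim/big_rec2: _ => [|i x p _ <-]; rewrite ?form0l ?SD. Qed.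

Lemma formDr p q r : S p (q + r) = S p q + S p r.
Proof. by rewrite SH SD rmorphD/= -!SH. Qed.

Lemma formZr c p q : S p (c *: q) = c^* * S p q.
Proof. by rewrite SH SZ rmorphM/= -SH. Qed.

Lemma formBr p q r : S p (q - r) = S p q - S p r.
Proof. by rewrite SH formB rmorphB/= -!SH. Qed.

Lemma formXn k p q : S ('X^k * p) ('X^k * q) = S p q.
Proof. by elim: k => [|k IH]; rewrite ?expr0 ?mul1r// exprS -!mulrA SX. Qed.

Lemma form_shift p i j : (i <= j)%N -> S (p * 'X^i) 'X^j = S p 'X^(j - i).
Proof. by move=> ij; rewrite -{1}(subnKC ij) exprD mulrC formXn. Qed.

(** On the circle the left integrand is z^(n+a-b) times the conjugate of p; conjugating it gives the
    right one. Algebraically this is done monomial by monomial, using the isometry. *)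
Lemma form_revp n p a b : (size p <= n.+1)%N ->
  S (revp n p * 'X^a) 'X^b = (S (p * 'X^b) 'X^(n + a))^*.
Proof.
move=> sp; have {2}-> : p = \sum_(i < n.+1) p`_i *: 'X^i.
  rewrite -poly_def; apply/polyP => i; rewrite coef_poly.
  by case: ltnP => // ni; rewrite nth_default// (leq_trans sp).
rewrite revpE !mulr_suml !form_suml rmorph_sum/=; apply: eq_bigr => i _.
rewrite -!scalerAl !SZ rmorphM/= -SH; congr (_ * _).
have := formXn i 'X^(n - i + a) 'X^b.
by rewrite -!exprD addnA subnKC// -ltnS.
Qed.

Variable Phi : nat -> {poly C}.
Hypothesis Phi_monic : forall n, Phi n \is monic.
Hypothesis size_Phi : forall n, size (Phi n) = n.+1.
Hypothesis Phi_orth : forall n m, n != m -> S (Phi n) (Phi m) = 0.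

Lemma lead_Phi n : (Phi n)`_n = 1.
Proof. by have := monicP (Phi_monic n); rewrite lead_coefE size_Phi. Qed.

Lemma Phi_coef_gt n k : (n < k)%N -> (Phi n)`_k = 0.
Proof. by move=> nk; rewrite nth_default// size_Phi. Qed.

Lemma size_subPhi c m q : (size q <= m.+1)%N -> c = q`_m ->
  (size (q - c *: Phi m)%R <= m)%N.
Proof.
move=> sq ->; apply/leq_sizeP => j mj; rewrite coefB coefZ.
move: mj; rewrite leq_eqVlt => /predU1P[<-|mj]; first by rewrite lead_Phi mulr1 subrr.
by rewrite Phi_coef_gt// mulr0 subr0 nth_default// (leq_trans sq).
Qed.

(** Peeling off the leading term of q with a multiple of [Phi m], m < n, lowers the degree; hence
    the induction over all size bounds m <= n. *)
Lemma Phi_orthr n q : (size q <= n)%N -> S (Phi n) q = 0.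
Proof.
suff : forall m, (m <= n)%N -> forall q, (size q <= m)%N -> S (Phi n) q = 0.
  by move=> H sq; exact: (H n).
elim=> [|m IH] mn {}q sq.
  by move: sq; rewrite leqn0 size_poly_eq0 => /eqP ->; rewrite SH form0l conjC0.
rewrite -(subrK (q`_m *: Phi m) q) formDr formZr Phi_orth ?mulr0 ?addr0; last by rewrite gtn_eqF.
by apply: IH; [exact: ltnW|exact: size_subPhi].
Qed.

Lemma Phi_orthXn n k : (k < n)%N -> S (Phi n) 'X^k = 0.
Proof. by move=> kn; rewrite Phi_orthr// size_polyXn. Qed.

Definition normPhi n := S (Phi n) (Phi n).
Notation kappa := normPhi.

Lemma normPhi_neq0 n : kappa n != 0.
Proof.
apply/eqP => /S_eq0 P0; have := size_Phi n.
by rewrite P0 size_poly0.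
Qed.

Lemma conj_normPhi n : (kappa n)^* = kappa n.
Proof. by rewrite /normPhi -SH. Qed.

Lemma form_PhiXn n : S (Phi n) 'X^n = kappa n.
Proof.
have sX : (size ('X^n - 1 *: Phi n)%R <= n)%N.
  by apply: size_subPhi; rewrite ?size_polyXn// coefXn eqxx.
by have /eqP := Phi_orthr sX; rewrite scale1r formBr subr_eq0 => /eqP.
Qed.

(** Modulo degree less than n, z^(n+1) is Phi_(n+1) - l Phi_n, and only the term in Phi_n pairs
    nontrivially with Phi_n. *)
Lemma form_PhiXSn n : S (Phi n) 'X^(n.+1) = - ((Phi n.+1)`_n)^* * kappa n.
Proof.
set l := (Phi n.+1)`_n.
have s1 : (size ('X^(n.+1) - Phi n.+1)%R <= n.+1)%N.
  by have := @size_subPhi 1%R n.+1 'X^(n.+1); rewrite scale1r size_polyXn coefXn eqxx; apply.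
have /Phi_orthr : (size (('X^(n.+1) - Phi n.+1) - (- l) *: Phi n)%R <= n)%N.
  by apply: size_subPhi => //; rewrite coefB coefXn -/l ltn_eqF// sub0r.
rewrite !formBr formZr Phi_orth ?subr0; last by rewrite ltn_eqF.
by move/eqP; rewrite subr_eq0 => /eqP ->; rewrite rmorphN.
Qed.

Lemma form_revPhi n k : (0 < k <= n)%N -> S (revp n (Phi n)) 'X^k = 0.
Proof.
move=> /andP[k0 kn]; have := @form_revp n (Phi n) 0 k.
rewrite size_Phi expr0 mulr1 addn0 form_shift// => -> //.
by rewrite Phi_orthXn ?conjC0// ltn_subrL k0 (leq_trans k0).
Qed.

Lemma form_revPhi1 n : S (revp n (Phi n)) 1 = kappa n.
Proof.
have := @form_revp n (Phi n) 0 0.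
by rewrite size_Phi !expr0 !mulr1 addn0 form_PhiXn conj_normPhi => ->.
Qed.

(* The difference of the two sides vanishes at 0 and is orthogonal to
   z, ..., z^n, so it is z * E with E of degree < n orthogonal to itself. *)
Lemma szego n : Phi n.+1 = 'X * Phi n + (Phi n.+1)`_0 *: revp n (Phi n).
Proof.
apply/eqP; rewrite -subr_eq0 opprD addrA; set D := (X in X == 0).
have sD : (size D <= n.+1)%N.
  apply/leq_sizeP => j nj; rewrite !coefB coefZ coefXM.
  case: j nj => // j; rewrite ltnS => nj /=.
  rewrite coef_poly ltnS ltnNge nj mulr0 subr0.
  move: nj; rewrite leq_eqVlt => /predU1P[<-|nj]; first by rewrite !lead_Phi subrr.
  by rewrite !Phi_coef_gt// subrr.
have D0 : D`_0 = 0.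
  by rewrite !coefB coefZ coefXM/= subr0 coef_revp// subn0 lead_Phi conjC1 mulr1 subrr.
have DX k : (0 < k <= n)%N -> S D 'X^k = 0.
  case: k => // k kn; rewrite /D !formB SZ form_revPhi// mulr0 subr0.
  rewrite Phi_orthXn// exprS SX Phi_orthXn ?subrr//.
have [E DE] : exists E, D = 'X * E.
  exists (drop_poly 1 D); rewrite mulrC -{1}(poly_take_drop 1 D) expr1.
  rewrite (_ : take_poly 1 D = 0) ?add0r//.
  by apply/polyP => i; rewrite coef_take_poly coef0; case: i.
have sE : (size E <= n)%N.
  have [->|E0] := eqVneq E 0; first by rewrite size_poly0.
  by move: sD; rewrite DE mulrC size_mulX.
suff E0 : E = 0 by rewrite DE E0 mulr0.
apply: S_eq0; rewrite -{2}[E]coefK poly_def.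
rewrite SH form_suml big1 ?conjC0// => i _; rewrite SZ.
rewrite SH -SX -DE -exprS DX ?conjC0 ?mulr0//=.
by rewrite (leq_trans (ltn_ord i)).
Qed.

Notation v n := ((Phi n)`_0).

(** The Szego recursion solved for z Phi_n; Phi_(n+1) is orthogonal to 1. *)
Lemma form_XPhi n : S (Phi n * 'X) 1 = - v n.+1 * kappa n.
Proof.
have := szego n; rewrite mulrC => /eqP; rewrite -subr_eq => /eqP <-.
rewrite formB SZ form_revPhi1 -(expr0 'X) Phi_orthXn// sub0r mulNr//.
Qed.

(** The classical norm ratio 1 - |alpha_n|^2: pair the Szego recursion with z^(n+1). *)
Lemma normPhiS n : kappa n.+1 = (1 - v n.+1 * (v n.+1)^*) * kappa n.
Proof.
rewrite -form_PhiXn {1}szego SD SZ exprS SX form_PhiXn -exprS.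
have := @form_revp n (Phi n) 0 n.+1.
rewrite size_Phi expr0 mulr1 addn0 => -> //.
rewrite exprSr mulrCA -{2}['X^n]mulr1 formXn form_XPhi rmorphM rmorphN/= conj_normPhi.
ring.
Qed.

(** Multiply the Szego recursion by z before pairing with 1; the reversed polynomial contributes the
    subleading coefficient through [form_PhiXSn]. *)
Lemma form_X2Phi n : S (Phi n * 'X^2) 1 =
  - v n.+2 * kappa n.+1 + v n.+1 * (Phi n.+1)`_n * kappa n.
Proof.
rewrite -form_XPhi [in X in _ = X + _]szego mulrDl SD -scalerAl SZ.
have := @form_revp n (Phi n) 1 0.
rewrite size_Phi expr0 mulr1 addn1 => -> //.
rewrite form_PhiXSn rmorphM rmorphN/= conjCK conj_normPhi.
have -> : 'X * Phi n * 'X = Phi n * 'X^2 by ring.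
ring.
Qed.

Lemma subleadPhiS n : (Phi n.+2)`_n.+1 = (Phi n.+1)`_n + v n.+2 * (v n.+1)^*.
Proof. by rewrite {1}szego coefD coefXM coefZ coef_revp// subnn. Qed.

Lemma Phi_coef1 n : (Phi n.+2)`_1 = v n.+1 + v n.+2 * ((Phi n.+1)`_n)^*.
Proof. by rewrite {1}szego coefD coefXM coefZ coef_revp// subn1. Qed.

(** The monomial z^j of P contributes the pairing of Phi_n with z^(n+1-j), which vanishes for 2 <= j
    <= n+1. The four remaining exponents are 0, 1, n+2 and n+3. *)
Lemma form_PhiM n (P : {poly C}) : (0 < n)%N -> (size P <= n.+4)%N ->
  S (Phi n * P) 'X^(n.+1) =
    P`_0 * S (Phi n) 'X^(n.+1) + P`_1 * kappa n
    + P`_n.+2 * S (Phi n * 'X) 1 + P`_n.+3 * S (Phi n * 'X^2) 1.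
Proof.
move=> n0 sP; have {1}-> : P = \sum_(i < n.+4) P`_i *: 'X^i.
  rewrite -poly_def; apply/polyP => i; rewrite coef_poly.
  by case: ltnP => // ni; rewrite nth_default// (leq_trans sP).
rewrite mulr_sumr form_suml.
under eq_bigr do rewrite -scalerAr SZ.
rewrite 2!big_ord_recr 2!big_ord_recl /= big1 ?addr0; last first.
  move=> i _; rewrite form_shift ?/bump/= ?Phi_orthXn ?mulr0//.
    by rewrite !add1n subSS ltn_subrL n0.
  by rewrite !add1n ltnS ltn_ord.
have shift j : S (Phi n * 'X^(n.+1 + j)) 'X^(n.+1) = S (Phi n * 'X^j) 1.
  by rewrite exprD mulrCA -{2}['X^(n.+1)]mulr1 formXn.
have -> : S (Phi n * 'X^(n.+3)) 'X^(n.+1) = S (Phi n * 'X^2) 1 by rewrite -shift addn2.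
have -> : S (Phi n * 'X^(n.+2)) 'X^(n.+1) = S (Phi n * 'X) 1 by rewrite -(shift 1%N) addn1.
by rewrite expr0 mulr1 form_shift// subSS subn0 form_PhiXn.
Qed.

(** * The recurrence derived from the Pearson identity *)

Variables A B : {poly C}.
Hypothesis sA : (size A <= 4)%N.
Hypothesis sB : (size B <= 4)%N.
(** This is L(i z f' A + f B) = 0 for f = p z^(-m), with z^(-m) placed in the second argument as a
    conjugate. *)
Hypothesis pearsonS : forall p m,
  S (('i *: ('X * p^`() - m%:R *: p)) * A + p * B) 'X^m = 0.

(* In the paper's notation, v n = - conj alpha_(n-1); this is the conjugate of
   the stated recurrence. *)
Lemma verblunsky_recurrence n : (2 <= n)%N ->
  ((n%:R - 1) * A`_0 + 'i * B`_0) * (1 - v n * (v n)^*) * v n.-1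
  + ((n%:R - 1) * A`_3 - 'i * B`_3) * (1 - v n.+1 * (v n.+1)^*) * v n.+2
  = - ((n%:R - 1) * A`_2 - 'i * B`_2
       - ((n%:R - 1) * A`_3 - 'i * B`_3) * v n.+1 * (v n)^*
       - 2 * A`_3 * (Phi n)`_n.-1) * v n.+1
    - ((n%:R + 1) * A`_1 + 'i * B`_1
       - ('i * B`_0 + (n%:R + 1) * A`_0) * (v n.+1)^* * v n
       - 2 * A`_0 * ((Phi n)`_n.-1)^*) * v n.
Proof.
case: n => [|[|n]]// _.
(* For f = z^(-n-3) Phi_(n+2)^2, z f' equals z^(-n-3) Phi_(n+2) Q, so one factor Phi_(n+2) splits
   off the whole identity. *)
pose Q := 2 *: ('X * (Phi n.+2)^`()) - n.+3%:R *: Phi n.+2.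
have QE k : Q`_k = (2 * k%:R - n.+3%:R) * (Phi n.+2)`_k.
  rewrite coefB !coefZ coefXM mulrBl; congr (_ - _).
  case: k => [|k] /=; first by rewrite mulr0 mul0r.
  by rewrite coef_deriv -[_ *+ k.+1]mulr_natl mulrA.
have sQ : (size Q <= n.+3)%N.
  by apply/leq_sizeP => k nk; rewrite QE Phi_coef_gt ?mulr0.
pose P := 'i *: (A * Q) + B * Phi n.+2.
have sM (D : {poly C}) q : (size D <= 4)%N -> (size q <= n.+3)%N -> (size (D * q)%R <= n.+2.+4)%N.
  by move=> sD sq; have := size_polyMleq D q; lia.
have sP : (size P <= n.+2.+4)%N.
  rewrite (leq_trans (size_polyD _ _))// geq_max (leq_trans (size_scale_leq _ _)) ?sM//.
  by rewrite size_Phi.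
have := pearsonS (Phi n.+2 * Phi n.+2) n.+3.
have -> : 'i *: ('X * (Phi n.+2 * Phi n.+2)^`() - n.+3%:R *: (Phi n.+2 * Phi n.+2)) * A + (Phi n.+2 * Phi n.+2) * B = Phi n.+2 * P.
  rewrite /P /Q derivM -!mul_polyC; ring.
rewrite form_PhiM //.
have PE k : P`_k = 'i * (A * Q)`_k + (B * Phi n.+2)`_k by rewrite coefD coefZ.
rewrite !PE !coefM4//= !QE.
have Phi_gt k : (Phi n.+2)`_(n.+3 + k) = 0 by rewrite Phi_coef_gt// ltnS leq_addr.
have := (Phi_gt 0, Phi_gt 1, Phi_gt 2); rewrite addn0 addn1 addn2 => Phi0.
rewrite !Phi0.
(* Now every term carries the factor [normPhi n.+2], and the next rewrites reduce all subleading
   coefficients to that of Phi_(n+1). *)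
rewrite form_PhiXSn form_XPhi form_X2Phi (normPhiS n.+2) Phi_coef1 lead_Phi.
rewrite (subleadPhiS n.+1) (subleadPhiS n).
rewrite !rmorphD !rmorphM/= !conjCK.
(* In terms of i * B_j the identity no longer involves i ^ 2 = -1. *)
have iK (z : C) : z = - 'i * ('i * z) by rewrite mulrA mulNr -expr2 sqrCi opprK mul1r.
move=> E; rewrite [B`_0]iK [B`_1]iK [B`_2]iK [B`_3]iK in E; move: E.
move: ('i * B`_0) ('i * B`_1) ('i * B`_2) ('i * B`_3) => b0 b1 b2 b3 E.
apply/eqP; rewrite -subr_eq0; set X := (X in X == 0).
have : 'i * kappa n.+2 * X = 0 by rewrite -[RHS]oppr0 -E /X; ring.
move/eqP; rewrite mulf_eq0 => /orP[|/eqP//].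
by rewrite mulf_eq0 (negPf (neq0Ci _)) (negPf (normPhi_neq0 _)).
Qed.

End OrthogonalPolynomials.

(** * The inner product of a weight on the circle *)

Section Inner.
Context {R : realType}.
Local Notation C := R[i].
Notation mu := (@lebesgue_measure R).
Variable w : R -> R.
Hypothesis w_pos : positive_weight w.
Implicit Types p q r : {poly C}.

Notation S p q := (inner w (horner p) (horner q)).

Lemma expi_mulJ (t : R) : expi t * (expi t)^* = 1.
Proof.
apply/eqP; rewrite eq_complex ReM ImM Re_conj Im_conj /= mulrN opprK -!expr2.
by rewrite cos2Dsin2 eqxx/= mulrN mulrC addNr.
Qed.

Lemma integrable_inner p q :
  integrable_C circle_interval (fun t => p.[expi t] * (q.[expi t])^* * (w t)%:C).
Proof. by apply: integrable_C_weight w_pos.1 _; exact: continuous_C_inner. Qed.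

Let mI : measurable (circle_interval : set R).
Proof. exact: measurable_itv. Qed.

Lemma innerD p q r : S (p + q) r = S p r + S q r.
Proof.
rewrite /inner -integral_CD//; try exact: integrable_inner.
by congr integral_C; apply/funext => t; rewrite hornerD !mulrDl.
Qed.

Lemma innerZ (c : C) p q : S (c *: p) q = c * S p q.
Proof.
rewrite /inner -integral_CZ//; last exact: integrable_inner.
by congr integral_C; apply/funext => t; rewrite hornerZ !mulrA.
Qed.

Lemma conj_real (x : R) : (x%:C)^* = x%:C.
Proof. by apply/eqP; rewrite eq_complex Re_conj Im_conj /= oppr0 !eqxx. Qed.

Lemma inner_conj p q : S q p = (S p q)^*.
Proof.
rewrite /inner -integral_C_conj//; last exact: integrable_inner.
congr integral_C; apply/funext => t.
by rewrite !rmorphM/= conjCK conj_real [X in X * _]mulrC.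
Qed.

Lemma innerX p q : S ('X * p) ('X * q) = S p q.
Proof.
rewrite /inner; congr integral_C; apply/funext => t.
rewrite !hornerE rmorphM/= -[RHS]mul1r -(expi_mulJ t); ring.
Qed.

Lemma finite_root p : p != 0 -> finite_set [set z | root p z].
Proof.
move=> p0; have [rs prs] := closed_field_poly_normal p.
apply: (@sub_finite_set _ _ [set` rs]); last exact: finite_seq.
move=> z /=; rewrite prs rootZ ?lead_coef_eq0//.
by rewrite root_prod_XsubC.
Qed.

(** On [0, pi] the map t to e^(it) is injective because cos is, so a nonzero p has finitely many
    zeros there. Then [0, pi] would be null, against its length pi. *)
Lemma horner_expi_ae0 p :
  {ae mu, forall t, t \in `[0, 2 * pi] -> p.[expi t] = 0} -> p = 0.
Proof.
move=> p_ae0; apply/eqP; apply: contrapT => /negP p0.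
have fin : finite_set (`[0, pi]%classic `&` [set t : R | root p (expi t)]).
  set A := (X in finite_set X).
  have expi_inj : {in A &, injective (@expi R)}.
    move=> x y /set_mem[x0 _] /set_mem[y0 _] /(congr1 (@complex.Re R)) /=.
    exact: cos_inj.
  rewrite -(eq_finite_set (inj_card_eq expi_inj)).
  by apply: sub_finite_set (finite_root p0) => _ /= [t [_ rt] <-].
have neg : mu.-negligible (`[0, pi]%classic : set R).
  apply: (negligibleS _ (negligibleU p_ae0 (_ : mu.-negligible (`[0, pi]%classic `&` [set t : R | root p (expi t)])))).
    move=> t /= /[dup] tpi; rewrite in_itv/= => /andP[t0 t_pi].
    have [rt|nrt] := boolP (root p (expi t)); [by right|left => /= H].
    move/negP: nrt; apply; apply/rootP/H; rewrite in_itv/= t0/=.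
    by rewrite (le_trans t_pi)// ler_peMl ?pi_ge0// ler1n.
  apply/negligibleP; last exact: countable_lebesgue_measure0 (finite_set_countable fin).
  by apply: countable_measurable (finite_set_countable fin) => t; exact: measurable_set1.
have := @measure_negligible _ _ _ mu _ (measurable_itv `[0, pi]) neg.
rewrite [X in X = _ -> _]lebesgue_measure_itv/= lte_fin pi_gt0 oppr0 adde0.
by move=> /eqP; rewrite eqe gt_eqF// pi_gt0.
Qed.

(** The integrand |p|^2 w is nonnegative with zero integral, hence zero almost everywhere, and w > 0
    almost everywhere. *)
Lemma inner_eq0 p : S p p = 0 -> p = 0.
Proof.
have [ir _] := integrable_inner p p.
have aeF := ae_filter_ringOfSetsType mu.
move=> /(congr1 (@complex.Re R)) /= int0; apply: horner_expi_ae0.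
set f := (fun t => _) in ir int0.
have fE t : f t = (complex.Re p.[expi t] ^+ 2 + complex.Im p.[expi t] ^+ 2) * w t.
  by rewrite /f !ReM Re_conj Im_conj /= mulr0 subr0; ring.
have mf : measurable_fun circle_interval (EFin \o f) by exact: measurable_int ir.
have f_eq0 : ae_eq mu circle_interval (EFin \o f) (cst 0%E).
  apply/(ae_eq_integral_abs mu mI mf).
  rewrite -(@ae_eq_integral _ _ _ mu circle_interval _ (EFin \o f))//; last 2 first.
  - exact: measurableT_comp.
  - move: w_pos.2; apply: filterS => t wt It; rewrite /= ger0_norm// fE.
    by rewrite mulr_ge0 ?addr_ge0 ?sqr_ge0// ltW// wt.
  rewrite -[LHS]fineK ?[fine _]int0//.
  exact: integrable_fin_num ir.
move: w_pos.2 f_eq0; apply: filterS2 => t wt ft0 It.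
have [] := (wt It, ft0 It); rewrite /= fE => wt0 [/eqP].
rewrite mulf_eq0 (gt_eqF wt0) orbF paddr_eq0 ?sqr_ge0// !sqrf_eq0.
by case: (p.[expi t]) => x y /= /andP[/eqP -> /eqP ->].
Qed.

(** The integrand is the derivative of p z^(-m) A w along the circle, so the integral is a boundary
    difference. *)
Lemma inner_pearson (A B p : {poly C}) m : pearson w A B ->
  A.[1] * (w (2 * pi) - w 0)%:C = 0 ->
  S (('i *: ('X * p^`() - m%:R *: p)) * A + p * B) 'X^m = 0.
Proof.
move=> [acA dA] bd; have aeF := ae_filter_ringOfSetsType mu.
have pi2 : 0 < 2 * pi :> R by rewrite mulr_gt0// pi_gt0.
pose u (t : R) : C := (p.[expi t] * ('X^m.[expi t])^*) * (A.[expi t] * (w t)%:C).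
have acu : AC_C 0 (2 * pi) u.
  apply: (AC_CM (ltW pi2) _ (absolutely_continuous_AC_C acA)).
  by apply: AC_CM (ltW pi2) _ (AC_C_conj _); apply: AC_C_horner (ltW pi2).
rewrite /inner (FTC_C pi2 acu (integrable_inner _ _)); last first.
  move: dA; apply: filterS => t dAt It; have {}dAt := dAt It.
  have := is_derive_CM (is_derive_CM (is_derive_C_horner p t)
    (is_derive_C_conj (is_derive_C_horner 'X^m t))) dAt.
  congr is_derive_C; rewrite !hornerE !rmorphM/= conjCi derivXn hornerMn hornerXn.
  rewrite rmorphMn/= -[X in _ * (- 'i * _ * X)]mulr_natl.
  (* For m = 0 the truncated exponent [m.-1] is harmless: the factor m vanishes. *)
  have -> : - 'i * (expi t)^* * (m%:R * (expi t ^+ m.-1)^*) = - 'i * m%:R * ((expi t) ^+ m)^*.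
    by case: (m) => [|k] /=; [ring|rewrite exprS rmorphM/=; ring].
  ring.
(* Both endpoints map to z = 1, so the difference is a multiple of A(1)(w(2 pi) - w(0)). *)
have expi0 : expi 0 = 1 :> C by rewrite /expi cos0 sin0.
have expi2pi : expi (2 * pi) = 1 :> C by rewrite /expi mulrC mulr_natr cos2pi sin2pi.
by rewrite /u expi0 expi2pi -mulrBr -mulrBr -rmorphB/= bd mulr0.
Qed.

End Inner.

(** * The recurrence for a weight on the circle *)

Theorem theorem2p3 (R : realType) (A B : {poly R[i]}) (w : R -> R)
    (Phi : nat -> {poly R[i]}) :
  (size A <= 4)%N -> (size B <= 4)%N ->
  positive_weight w ->
  pearson w A B ->
  A.[1] * (w (2 * pi) - w 0)%:C = 0 ->
  monic_orthogonal_polynomials w Phi ->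
  let a k := A`_k in
  let b k := B`_k in
  let alpha := verblunsky Phi in
  let l n k := (Phi n)`_k in
  forall n : nat, (3 <= n)%N ->
    ((n%:R - 1) * (a 0%N)^* - 'i * (b 0%N)^*)
        * (1 - `|alpha (n - 1)%N| ^+ 2) * alpha (n - 2)%N
    + ((n%:R - 1) * (a 3%N)^* + 'i * (b 3%N)^*)
        * (1 - `|alpha n| ^+ 2) * alpha (n + 1)%N
    = - ((n%:R - 1) * (a 2%N)^* + 'i * (b 2%N)^*
          - ('i * (b 3%N)^* + (n%:R - 1) * (a 3%N)^*)
              * alpha n * (alpha (n - 1)%N)^*
          - 2 * (a 3%N)^* * (l n (n - 1)%N)^*) * alpha n
      - ((n%:R + 1) * (a 1%N)^* - 'i * (b 1%N)^*
          + ('i * (b 0%N)^* - (n%:R + 1) * (a 0%N)^*)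
              * (alpha n)^* * alpha (n - 1)%N
          - 2 * (a 0%N)^* * l n (n - 1)%N) * alpha (n - 1)%N.
Proof.
move=> sA sB w_pos pAB bd [Phi_monic_size Phi_orth] a b alpha l n n3.
have := verblunsky_recurrence (innerD w_pos) (innerZ w_pos) (inner_conj w_pos)
  (innerX w) (@inner_eq0 _ _ w_pos) (fun n => (Phi_monic_size n).1)
  (fun n => (Phi_monic_size n).2) Phi_orth sA sB
  (fun p m => @inner_pearson _ _ w_pos _ _ p m pAB bd) (ltnW n3).
case: n n3 => [|[|[|n]]]// _.
(* The index becomes an atom fixed by conjugation. *)
move: (n.+3%:R : R[i]) (conjC_nat R[i] n.+3) => N conjN.
rewrite /alpha /verblunsky /a /b /l !subSS !subn0 addn1 /= !normrN !norm_conjC !normCK.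
rewrite !horner_coef0 => /(congr1 Num.conj).
rewrite !(rmorphD, rmorphB, rmorphN, rmorphM, rmorph1) /= !conjCK conjCi conjN.
(* The recurrence is odd in the values Phi_k(0), so substituting their negated conjugates only
   changes the overall sign. *)
move/eqP; rewrite -subr_eq0 => /eqP E; apply/eqP; rewrite -subr_eq0 -oppr_eq0.
by apply/eqP; rewrite -[RHS]E; ring.
Qed.
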